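(* Let $m \geq 1$ be an integer and let $A, B, C \in \mathbb{F}_2^{m\times m}$. Then the following are equivalent. (i) $(A,B,C)$ generates a digital $(0,m,3)$-net in base $2$. (ii) There exist $L_1, L_2 \in \mathcal{L}_m$, $U \in \mathcal{U}_m$, and a non-singular $M \in \mathbb{F}_2^{m\times m}$ such that \[ (A,B,C) = (J_m M,\; L_1 U M,\; L_2 P_m U M). \]
   Context: $\mathbb{F}_2=\{0,1\}$ is the field with two elements and $\mathbb{F}_2^{m\times m}$ is the set of $m\times m$ matrices over it. $\mathcal{L}_m$ (resp. $\mathcal{U}_m$) is the set of non-singular lower- (resp. upper-) triangular $m\times m$ matrices over $\mathbb{F}_2$. $J_m\in\mathbb{F}_2^{m\times m}$ is the anti-diagonal matrix whose anti-diagonal entries are all $1$ (and all other entries $0$). $P_m=\left(\binom{j-1}{i-1}\right)_{i,j=1}^m$, with entries taken modulo $2$, is the upper-triangular Pascal matrix. Digital net: for a nonnegative integer $n$ write $n=\sum_{i\ge1} z_i(n)2^{i-1}$ with $z_i(n)\in\{0,1\}$. Define $\phi_m:\mathbb{F}_2^m\to[0,1]$ by $\phi_m((y_1,\dots,y_m)^\top)=\sum_{i=1}^m y_i 2^{-i}$ (identifying elements of $\mathbb{F}_2$ with the integers $0,1$). For $C_1,\dots,C_s\in\mathbb{F}_2^{m\times m}$ and $0\le n<2^m$ put $\boldsymbol{y}_{n,j}=C_j\cdot(z_1(n),\dots,z_m(n))^\top\in\mathbb{F}_2^m$ and $\boldsymbol{x}_n=(\phi_m(\boldsymbol{y}_{n,1}),\dots,\phi_m(\boldsymbol{y}_{n,s}))$.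 The digital net generated by $(C_1,\dots,C_s)$ consists of the $2^m$ points $\boldsymbol{x}_0,\dots,\boldsymbol{x}_{2^m-1}\in[0,1)^s$ (counted with multiplicity). $(t,m,s)$-net: $2^m$ points in $[0,1)^s$ form a $(t,m,s)$-net in base $2$ if every interval of the form $\prod_{i=1}^s[a_i/2^{c_i},(a_i+1)/2^{c_i})$ with integers $c_i\ge0$, $0\le a_i<2^{c_i}$, and of volume $2^{t-m}$ contains exactly $2^t$ of the points. ''$(C_1,\dots,C_s)$ generates a digital $(t,m,s)$-net in base $2$'' means that the digital net generated by $(C_1,\dots,C_s)$ is a $(t,m,s)$-net in base $2$. *)

(* Defs.v *)
From mathcomp Require Import all_boot all_order all_algebra.

Set Implicit Arguments.
Unset Strict Implicit.
Unset Printing Implicit Defensive.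

Import GRing.Theory Num.Theory.
Local Open Scope ring_scope.

(* All row, column and digit indices are shifted to start at 0. *)

Definition lower_unitmx (m : nat) : {set 'M['F_2]_m} :=
  [set L | (L \in unitmx) && is_trig_mx L].

(* [is_trig_mx] means lower triangular. *)
Definition upper_unitmx (m : nat) : {set 'M['F_2]_m} :=
  [set U | (U \in unitmx) && is_trig_mx U^T].

Definition antidiag_mx (m : nat) : 'M['F_2]_m :=
  \matrix_(i < m, j < m) ((i + j).+1 == m)%:R.

Definition pascal_mx (m : nat) : 'M['F_2]_m :=
  \matrix_(i < m, j < m) 'C(j, i)%:R.

Definition digit (n i : nat) : bool := odd (n %/ 2 ^ i).

Definition digit_vec (m n : nat) : 'cV['F_2]_m := \col_(i < m) (digit n i)%:R.

Definition phi (R : realFieldType) (m : nat) (y : 'cV['F_2]_m) : R :=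
  \sum_(i < m) (y i ord0 : nat)%:R / 2 ^+ i.+1.

Definition digital_net (R : realFieldType) (m s : nat)
    (C : s.-tuple 'M['F_2]_m) (n : 'I_(2 ^ m)) : 'rV[R]_s :=
  \row_(j < s) phi R (tnth C j *m digit_vec m n).

Definition dyadic (R : realFieldType) (c a : nat) : R := a%:R / 2 ^+ c.

(* A point set is a family indexed by 'I_(2 ^ m), so that counting indices
   counts points with multiplicity. *)
Definition is_net (R : realFieldType) (t m s : nat)
    (x : 'I_(2 ^ m) -> 'rV[R]_s) : Prop :=
  (forall n i, 0 <= x n ord0 i < 1) /\
  forall c a : 'I_s -> nat,
    (forall i, (a i < 2 ^ c i)%N) ->
    \prod_(i < s) (dyadic R (c i) (a i).+1 - dyadic R (c i) (a i))
      = 2 ^+ t / 2 ^+ m ->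
    #|[set n | [forall i, dyadic R (c i) (a i) <= x n ord0 i
                            < dyadic R (c i) (a i).+1]]| = (2 ^ t)%N.

Definition generates_digital_net (R : realFieldType) (t m s : nat)
    (C : s.-tuple 'M['F_2]_m) : Prop :=
  is_net t (digital_net R C).

(* Main.v *)
(* The net property of (A, B, C) means that, whenever a + b + c = m, only x = 0
   annihilates the first a rows of A, the first b rows of B and the first c
   rows of C.  This is invariant under lower triangular factors on the left and
   a common invertible factor on the right, so an LU decomposition reduces the
   theorem to the triple (J, 1, C).  Read a vector x as a polynomial of degree
   < m: then P substitutes X + 1 for X.  For C = P, a vector annihilated by
   the chosen rows has degree < b + c and is divisible by X^b (X + 1)^c, hence
   is 0.  Conversely, if (J, 1, C) has the property, induction on i shows that
   row i of C vanishes on all multiples of (X + 1)^(i+1), because over F_2 a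
   nonzero value is 1 and two such values cancel; so C P is lower triangular,
   and P is an involution. *)
Require Import Defs.
From mathcomp Require Import all_boot all_order all_algebra zify.

Set Implicit Arguments.
Unset Strict Implicit.
Unset Printing Implicit Defensive.

Import Order.TTheory GRing.Theory Num.Theory.
Local Open Scope ring_scope.

(** * Triangular matrices, leading zeros and LU decomposition *)

Lemma unitmx_ker0 (F : fieldType) (m : nat) (A : 'M[F]_m) :
  (forall x : 'cV_m, A *m x = 0 -> x = 0) -> A \in unitmx.
Proof.
move=> A_inj; rewrite -unitmx_tr -row_free_unit.
apply: inj_row_free => v vA0; rewrite -[v]trmxK.
by rewrite [v^T]A_inj ?trmx0 // -[A]trmxK -trmx_mul vA0 trmx0.
Qed.

Lemma col_mulmx (R : pzSemiRingType) (m n p : nat) (A : 'M[R]_(m, n))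
    (B : 'M_(n, p)) j :
  col j (A *m B) = A *m col j B.
Proof. by rewrite !colE mulmxA. Qed.

Section HeadVanishing.

Variables (F : fieldType) (m : nat).
Implicit Types (k : nat) (x y : 'cV[F]_m) (A B C L U : 'M[F]_m).

Definition head0 k y : Prop := forall i : 'I_m, (i < k)%N -> y i ord0 = 0.

Lemma is_trig_mx_head0 L :
  (forall j : 'I_m, head0 j (col j L)) -> is_trig_mx L.
Proof. by move=> L0; apply/is_trig_mxP => i j /L0; rewrite mxE. Qed.

Lemma trig_unit_diag L (i : 'I_m) :
  L \in unitmx -> is_trig_mx L -> L i i != 0.
Proof.
rewrite unitmxE unitfE => + Lt; rewrite (det_trig Lt) => /prodf_neq0.
exact.
Qed.

(** Forward substitution: the diagonal of [L] has no zero, so the entries of [y] vanish one after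
    another. *)
Lemma trig_head0 k L y :
  L \in unitmx -> is_trig_mx L -> head0 k (L *m y) -> head0 k y.
Proof.
move=> Lu Lt Ly0 i; have [n] := ubnP (i : nat).
elim: n i => // n IHn i; rewrite ltnS => lein ik.
have /eqP := Ly0 i ik; rewrite mxE (bigD1 i) //= big1 ?addr0.
  by rewrite mulf_eq0 (negPf (trig_unit_diag i Lu Lt)) => /eqP.
move=> j; rewrite -val_eqE neq_ltn => /orP[ji|ij].
  rewrite IHn ?mulr0 //; first exact: leq_trans ji lein.
  exact: ltn_trans ji ik.
by move/is_trig_mxP: Lt => ->; rewrite ?mul0r.
Qed.

(** [L] sends column [j] of its inverse to the unit vector of index [j], whose first [j] entries are
    0; [trig_head0] carries these zeros back to the column. *)
Lemma is_trig_mx_inv L :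
  L \in unitmx -> is_trig_mx L -> is_trig_mx (invmx L).
Proof.
move=> Lu Lt; apply: is_trig_mx_head0 => j.
apply: (trig_head0 Lu Lt); rewrite -col_mulmx mulmxV // => i ij.
by rewrite !mxE -val_eqE /= ltn_eqF.
Qed.

Lemma is_trig_tr_inv U :
  U \in unitmx -> is_trig_mx U^T -> is_trig_mx (invmx U)^T.
Proof. by move=> Uu Ut; rewrite trmx_inv is_trig_mx_inv ?unitmx_tr. Qed.

(* Kernel form of nonvanishing leading principal minors. *)
Lemma LU_decomposition B :
  (forall k x, (forall i : 'I_m, (k <= i)%N -> x i ord0 = 0) ->
     head0 k (B *m x) -> x = 0) ->
  exists L U, [/\ L \in unitmx, is_trig_mx L, U \in unitmx,
                  is_trig_mx U^T & B = L *m U].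
Proof.
move=> Binj.
have Nex (j : 'I_m) : exists x : 'cV[F]_m,
    (forall i : 'I_m, (j < i)%N -> x i ord0 = 0) /\
    (forall i : 'I_m, (i <= j)%N -> (B *m x) i ord0 = (i == j)%:R).
  (* With the rows up to [j] taken from [B] and the others from the identity, both conditions on [x]
     become the single equation that [N *m x] is the unit vector of index [j]. *)
  pose N := \matrix_(i < m) if (i <= j)%N then row i B else row i 1%:M.
  have NE (x : 'cV[F]_m) (i : 'I_m) :
      (N *m x) i ord0 = if (i <= j)%N then (B *m x) i ord0 else x i ord0.
    transitivity (row i (N *m x) ord0 ord0); first by rewrite [RHS]mxE.
    rewrite row_mul rowK; case: ifP => _; by rewrite -row_mul ?mul1mx [LHS]mxE.
  have Nu : N \in unitmx.
    apply: unitmx_ker0 => x Nx0; apply: (Binj j.+1) => i ij.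
      by have := NE x i; rewrite Nx0 mxE leqNgt ij /= => ->.
    by have := NE x i; rewrite Nx0 mxE -ltnS ij /= => ->.
  exists (invmx N *m delta_mx j ord0); split=> i ij.
    have := NE (invmx N *m delta_mx j ord0) i.
    rewrite mulKVmx // leqNgt ij /= => <-.
    by rewrite mxE eqxx andbT -val_eqE gtn_eqF.
  have := NE (invmx N *m delta_mx j ord0) i.
  by rewrite mulKVmx // ij => <-; rewrite mxE eqxx andbT.
have [x xP] := fin_all_exists Nex.
(* The solutions are the columns of an upper triangular [X] for which [B *m X] is lower triangular
   with unit diagonal; these give the two factors. *)
pose X := \matrix_(i < m, j < m) x j i ord0.
have colX j : col j X = x j by apply/colP => i; rewrite !mxE.
have BXE (i j : 'I_m) : (B *m X) i j = (B *m x j) i ord0.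
  by rewrite -colX -col_mulmx [RHS]mxE.
have BXt : is_trig_mx (B *m X).
  apply/is_trig_mxP => i j ij; rewrite BXE (xP j).2 ?(ltnW ij) //.
  by rewrite -val_eqE ltn_eqF.
have BXu : B *m X \in unitmx.
  rewrite unitmxE unitfE (det_trig BXt); apply/prodf_neq0 => i _.
  by rewrite BXE (xP i).2 // eqxx oner_neq0.
have Xu : X \in unitmx by move: BXu; rewrite unitmx_mul => /andP[].
exists (B *m X), (invmx X); split; rewrite ?unitmx_inv ?mulmxK //.
apply: is_trig_tr_inv => //; apply/is_trig_mxP => i j ij.
by rewrite !mxE (xP i).1.
Qed.

Definition net_cond A B C : Prop :=
  forall a b c, (a + b + c = m)%N -> forall x,
    head0 a (A *m x) -> head0 b (B *m x) -> head0 c (C *m x) -> x = 0.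

Lemma net_condMr A B C M : M \in unitmx ->
  net_cond A B C -> net_cond (A *m M) (B *m M) (C *m M).
Proof.
move=> Mu netABC a b c abc x; rewrite -!mulmxA => Ax Bx Cx.
by rewrite -[x](mulKmx Mu) (netABC a b c abc _ Ax Bx Cx) mulmx0.
Qed.

Lemma net_condMl A B C L0 L1 L2 :
  L0 \in unitmx -> is_trig_mx L0 -> L1 \in unitmx -> is_trig_mx L1 ->
  L2 \in unitmx -> is_trig_mx L2 ->
  net_cond A B C -> net_cond (L0 *m A) (L1 *m B) (L2 *m C).
Proof.
move=> Lu0 Lt0 Lu1 Lt1 Lu2 Lt2 netABC a b c abc x; rewrite -!mulmxA.
move=> /(trig_head0 Lu0 Lt0) Ax /(trig_head0 Lu1 Lt1) Bx.
by move=> /(trig_head0 Lu2 Lt2); apply: (netABC a b c abc).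
Qed.

End HeadVanishing.

(** * The antidiagonal matrix as order reversal *)

Section Antidiagonal.

Variable m : nat.
Local Notation J := (antidiag_mx m).

Lemma antidiag_row (n : nat) (A : 'M['F_2]_(m, n)) (i : 'I_m) j :
  (J *m A) i j = A (rev_ord i) j.
Proof.
rewrite mxE (bigD1 (rev_ord i)) //= mxE big1 => [|k].
  have -> : ((i + rev_ord i).+1 == m)%N
    by apply/eqP => /=; have := ltn_ord i; lia.
  by rewrite mul1r addr0.
rewrite mxE -val_eqE => /= ik.
suff -> : ((i + k).+1 == m)%N = false by rewrite mul0r.
by have := ltn_ord k; lia.
Qed.

Lemma antidiag_mxK : J *m J = 1%:M.
Proof.
apply/matrixP => i j; rewrite antidiag_row !mxE -val_eqE /=.
by congr (_%:R); have := ltn_ord j; have := ltn_ord i; lia.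
Qed.

Lemma antidiag_unit : J \in unitmx.
Proof. by case: (mulmx1_unit antidiag_mxK). Qed.

Lemma tr_antidiag : J^T = J.
Proof. by apply/matrixP => i j; rewrite !mxE addnC. Qed.

(** Conjugation by [J] reverses the order of rows and of columns, which exchanges the two triangular
    shapes. *)
Lemma antidiag_conj_trig (U : 'M['F_2]_m) :
  is_trig_mx U^T -> is_trig_mx (J *m U *m J).
Proof.
move=> /is_trig_mxP Ut; apply/is_trig_mxP => i j ij.
rewrite -mulmxA antidiag_row -[U]trmxK -tr_antidiag -trmx_mul mxE.
by rewrite antidiag_row Ut //=; have := ltn_ord j; lia.
Qed.

Lemma head0_antidiag k (x : 'cV['F_2]_m) :
  head0 k (J *m x) <-> forall i : 'I_m, (m - k <= i)%N -> x i ord0 = 0.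
Proof.
split=> x0 i ik; last by rewrite antidiag_row x0 //=; lia.
by rewrite -[i]rev_ordK -antidiag_row x0 //=; have := ltn_ord i; lia.
Qed.

(** Since [J U = (J U J) J] with [J U J] lower triangular, the effect of [U] on the first matrix is
    undone by a lower triangular left factor. *)
Lemma net_cond_antidiagMr (B C U : 'M['F_2]_m) :
  U \in unitmx -> is_trig_mx U^T ->
  net_cond J B C -> net_cond J (B *m U) (C *m U).
Proof.
move=> Uu Ut /(net_condMr Uu).
set V := invmx (J *m U *m J).
have JUJu : J *m U *m J \in unitmx by rewrite !unitmx_mul antidiag_unit Uu.
have Vu : V \in unitmx by rewrite unitmx_inv.
have Vt : is_trig_mx V by rewrite is_trig_mx_inv ?antidiag_conj_trig.
move=> /(net_condMl Vu Vt (unitmx1 _ _) (scalar_mx_is_trig _ _)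
                          (unitmx1 _ _) (scalar_mx_is_trig _ _)).
rewrite !mul1mx; suff -> : V *m (J *m U) = J by [].
rewrite -[in LHS](mulmx1 (J *m U)) -antidiag_mxK.
by rewrite mulmxA mulmxA mulVmx ?mul1mx.
Qed.

End Antidiagonal.

(** * The Pascal matrix and polynomials over F_2 *)

Section Pascal.

Variable m : nat.
Local Notation J := (antidiag_mx m).
Local Notation P := (pascal_mx m).

Lemma coef_Xadd1X (R : comNzRingType) (n i : nat) :
  (('X + 1 : {poly R}) ^+ n)`_i = 'C(n, i)%:R.
Proof.
rewrite exprD1n coef_sum; have [ni|ni] := ltnP n i.
  rewrite bin_small // big1 // => j _; rewrite coefMn coefXn.
  by rewrite gtn_eqF ?mul0rn // (leq_ltn_trans _ ni) // -ltnS.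
rewrite (bigD1 (inord i)) //= big1 => [|j].
  by rewrite coefMn coefXn inordK ?ltnS // eqxx addr0.
rewrite -val_eqE /= inordK ?ltnS // => ji.
by rewrite coefMn coefXn eq_sym (negPf ji) mul0rn.
Qed.

Lemma rVpoly_coef_ge (R : nzRingType) (v : 'rV[R]_m) k :
  (m <= k)%N -> (rVpoly v)`_k = 0.
Proof. by move=> mk; rewrite coef_rVpoly insubF // ltnNge mk. Qed.

Lemma size_Xadd1 : size ('X + 1 : {poly 'F_2}) = 2.
Proof. exact: size_XaddC. Qed.

(** Column [j] of [P] lists the coefficients of [(X + 1)^j]. *)
Lemma rVpoly_pascal (x : 'cV['F_2]_m) :
  rVpoly (P *m x)^T = rVpoly x^T \Po ('X + 1).
Proof.
have size_x : (size (rVpoly x^T) <= m)%N by apply: size_poly.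
apply/polyP => k; have [km|mk] := ltnP k m; last first.
  rewrite rVpoly_coef_ge // nth_default //.
  by rewrite size_comp_poly2 ?size_Xadd1 // (leq_trans size_x).
rewrite (coef_rVpoly_ord _ (Ordinal km)) !mxE coef_comp_poly.
rewrite (big_ord_widen m (fun i => (rVpoly x^T)`_i * (('X + 1) ^+ i)`_k)) //.
rewrite [RHS]big_mkcond; apply: eq_bigr => i _.
rewrite !mxE coef_Xadd1X (coef_rVpoly_ord _ i) mxE mulrC.
case: ltnP => // xi; suff -> : x i ord0 = 0 by rewrite mul0r.
by have := nth_default 0 xi; rewrite (coef_rVpoly_ord _ i) mxE.
Qed.

(** Substituting [X + 1] twice gives [X + 2], which is [X] in characteristic 2. *)
Lemma pascal_mxK : P *m P = 1%:M.
Proof.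
suff PPx (x : 'cV['F_2]_m) : P *m (P *m x) = x.
  apply/matrixP => i j; have := PPx (delta_mx j ord0).
  by rewrite mulmxA -colE => /colP/(_ i); rewrite !mxE eqxx andbT.
apply/trmx_inj/(can_inj rVpolyK); rewrite !rVpoly_pascal.
have -> : 'X + 1 = 'X + 1%:P :> {poly 'F_2} by rewrite polyC1.
rewrite -[RHS](comp_polyXaddC_K _ 1); congr (_ \Po _).
by rewrite polyC1 -[in RHS]polyC1 -polyCN; congr ('X + _%:P); apply/val_inj.
Qed.

Lemma pascal_unit : P \in unitmx.
Proof. by case: (mulmx1_unit pascal_mxK). Qed.

Lemma dvdp_XnP (F : fieldType) n (p : {poly F}) :
  reflect (forall k, (k < n)%N -> p`_k = 0) ('X^n %| p).
Proof.
apply: (iffP idP) => [/dvdpP[q ->] k kn|p0]; first by rewrite coefMXn kn.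
rewrite -[p](poly_take_drop n).
suff -> : take_poly n p = 0 by rewrite add0r dvdp_mulIr.
by apply/polyP => k; rewrite coef_take_poly coef0; case: ifP => // /p0.
Qed.

Lemma poly_head0P k (x : 'cV['F_2]_m) : (k <= m)%N ->
  head0 k x <-> 'X^k %| rVpoly x^T.
Proof.
move=> km; split=> [x0|/dvdp_XnP x0 i ik].
  apply/dvdp_XnP => i ik.
  by rewrite (coef_rVpoly_ord _ (Ordinal (leq_trans ik km))) mxE x0.
by have := x0 i ik; rewrite coef_rVpoly_ord mxE.
Qed.

Lemma net_cond_pascal : net_cond J 1%:M P.
Proof.
move=> a b c abc x /head0_antidiag x_hi; rewrite mul1mx.
have [bm cm] : (b <= m)%N /\ (c <= m)%N by lia.
move=> /(poly_head0P _ bm)/dvdpP[R QE] /(poly_head0P _ cm).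
(* The third condition reads [X^c | R(X + 1) (X + 1)^b]; by coprimality [X^c] divides [R(X + 1)], so
   a nonzero [R] has size above [c]. The degree bound from [J] contradicts this. *)
rewrite rVpoly_pascal QE comp_polyM comp_Xn_poly.
rewrite Gauss_dvdpl; last first.
  rewrite coprimep_expl // coprimep_expr // coprimep_sym coprimepX.
  by rewrite rootE !hornerE.
move=> /dvdp_leq; rewrite size_polyXn size_comp_poly2 ?size_Xadd1 //.
have [R0 _|R0] := eqVneq R 0.
  by apply/trmx_inj/(can_inj rVpolyK); rewrite QE R0 mul0r trmx0 linear0.
rewrite comp_poly2_eq0 ?size_Xadd1 // => /(_ R0).
rewrite ltnNge => /negP[].
have : (size (R * 'X^b)%R <= b + c)%N.
  rewrite -QE; apply/leq_sizeP => k bck.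
  have [km|mk] := ltnP k m; last exact: rVpoly_coef_ge.
  by rewrite (coef_rVpoly_ord _ (Ordinal km)) mxE x_hi //=; lia.
by rewrite size_Mmonic ?monicXn ?size_polyXn ?addnS /= 1?addnC ?leq_add2l.
Qed.

Lemma F2_neq0 (u : 'F_2) : u != 0 -> u = 1.
Proof. by case: u => [[|[|]]] //= ? _; apply/val_inj. Qed.

Section RowFunctionals.

Variable C : 'M['F_2]_m.
Hypothesis netC : net_cond J 1%:M C.

(** Row [i] of [C] as a linear functional on polynomials; [poly_rV] discards the coefficients from
    degree [m] on. *)
Let f (i : 'I_m) (p : {poly 'F_2}) : 'F_2 := (C *m (poly_rV p)^T) i ord0.

Let fD i p q : f i (p + q) = f i p + f i q.
Proof. by rewrite /f !linearD mxE. Qed.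

Let fsum i (n : nat) (p : 'I_n -> {poly 'F_2}) :
  f i (\sum_(k < n) p k) = \sum_(k < n) f i (p k).
Proof. by rewrite /f !linear_sum summxE. Qed.

Let fZ i a p : f i (a *: p) = a * f i p.
Proof. by rewrite /f !linearZ mxE. Qed.

(* [f i] takes the value 1 on all X^c (X + 1)^i, by [netC] and the vanishing
   of the previous rows there, so it cancels on
   X^c (X + 1)^(i+1) = X^(c+1) (X + 1)^i + X^c (X + 1)^i. *)
Lemma row_functional_vanish (i : 'I_m) (g : {poly 'F_2}) :
  (size g + i < m)%N -> f i (g * ('X + 1) ^+ i.+1) = 0.
Proof.
have [n] := ubnP (i : nat); elim: n i g => // n IHn i g.
rewrite ltnS => lein size_g.
have f1 c : (c + i < m)%N -> f i ('X^c * ('X + 1) ^+ i) = 1.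
  move=> cim; apply: F2_neq0; apply/negP => /eqP fi0.
  set p := 'X^c * _ in fi0.
  have p_monic : p \is monic.
    by rewrite monicMl ?monicXn // monic_exp // -polyC1 monicXaddC.
  have size_p : size p = (c + i).+1.
    rewrite size_monicM ?monicXn -?size_poly_eq0 ?size_polyXn //=.
      by rewrite -[1]polyC1 -[1%:P]opprK -polyCN size_exp_XsubC addnS.
    by rewrite -[1]polyC1 -[1%:P]opprK -polyCN size_exp_XsubC.
  have pK : rVpoly (poly_rV p : 'rV_m) = p by rewrite poly_rV_K ?size_p.
  suff p0 : (poly_rV p : 'rV['F_2]_m)^T = 0.
    have := monic_neq0 p_monic; rewrite -pK.
    by rewrite -[poly_rV p]trmxK p0 trmx0 linear0 eqxx.
  (* The three summands match the degree [c + i] of [p], its factor [X^c], and the rows of [C] up to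
     [i]: row [i] by [fi0], the earlier ones by induction. *)
  have abc : (m - (c + i).+1 + c + i.+1 = m)%N by lia.
  refine (netC abc _ _ _).
  - apply/head0_antidiag => k ck.
    by rewrite !mxE nth_default // size_p; lia.
  - rewrite mul1mx; apply/poly_head0P; first by lia.
    by rewrite trmxK pK dvdp_mulIl.
  move=> k; rewrite ltnS leq_eqVlt => /predU1P[/val_inj-> //|ki].
  suff: f k p = 0 by [].
  (* Splitting [(X + 1)^(k+1)] off [(X + 1)^i] makes [p] a multiple to which induction applies for
     row [k]. *)
  rewrite /p -(subnK ki) exprD mulrA IHn //; first exact: leq_trans ki lein.
  have := size_polyMleq ('X^c) (('X + 1) ^+ (i - k.+1) : {poly 'F_2}).
  rewrite size_polyXn -[1]polyC1 -[1%:P]opprK -polyCN size_exp_XsubC /=.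
  lia.
(* By linearity only monomials [g = X^k] matter; the bound on [size g] gives [k + 1 + i < m], as
   [f1] requires. *)
rewrite -[g]coefK poly_def mulr_suml fsum big1 // => k _.
have kg := ltn_ord k.
rewrite -scalerAl fZ exprS mulrDl mul1r mulrDr mulrA -exprSr.
rewrite fD !f1; try lia.
by rewrite [X in _ * X](_ : _ = 0) ?mulr0 //; apply/val_inj.
Qed.

(** Entry [(i, j)] is the value of [f i] at [(X + 1)^j], a multiple of [(X + 1)^(i+1)] when
    [i < j]. *)
Lemma net_cond_mul_pascal_trig : is_trig_mx (C *m P).
Proof.
apply/is_trig_mxP => i j ij.
have -> : (C *m P) i j = f i (('X + 1) ^+ j).
  transitivity (col j (C *m P) i ord0); first by rewrite [RHS]mxE.
  rewrite col_mulmx; congr ((_ *m _) i ord0); apply/colP => k.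
  by rewrite !mxE coef_Xadd1X.
rewrite -(subnK ij) exprD row_functional_vanish //.
rewrite -[1]polyC1 -[1%:P]opprK -polyCN size_exp_XsubC.
by have := ltn_ord j; lia.
Qed.

End RowFunctionals.

End Pascal.

(** * The kernel condition and the matrix factorization *)

Theorem net_condP (m : nat) (A B C : 'M['F_2]_m) :
  net_cond A B C <->
  exists L1 L2 U M : 'M['F_2]_m,
    [/\ L1 \in lower_unitmx m, L2 \in lower_unitmx m,
        U \in upper_unitmx m, M \in unitmx &
        (A, B, C) = (antidiag_mx m *m M,
                     L1 *m U *m M,
                     L2 *m pascal_mx m *m U *m M)].
Proof.
set J := antidiag_mx m; set P := pascal_mx m; split=> [netABC|].
  have Au : A \in unitmx.
    apply: unitmx_ker0 => x Ax0; apply: (netABC m 0 0); rewrite ?addn0 //.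
    by rewrite Ax0 => i _; rewrite mxE.
  pose M := J *m A.
  have Mu : M \in unitmx by rewrite unitmx_mul antidiag_unit.
  have Mu' : invmx M \in unitmx by rewrite unitmx_inv.
  have AE : A = J *m M by rewrite mulmxA antidiag_mxK mul1mx.
  have := net_condMr Mu' netABC; rewrite {1}AE mulmxK //.
  set B' := B *m _; set C' := C *m _ => netB'C'.
  (* The splits [(m - k, k, 0)] of the kernel condition are exactly what the LU decomposition of
     [B'] needs. *)
  have [L1 [U [L1u L1t Uu Ut B'E]]] : exists L1 U,
      [/\ L1 \in unitmx, is_trig_mx L1, U \in unitmx,
          is_trig_mx U^T & B' = L1 *m U].
    apply: LU_decomposition => k x xk Bx0.
    have [mk|km] := leqP m k.
      apply: (netB'C' 0 m 0); rewrite ?addn0 // => i im.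
      by apply: Bx0; apply: leq_trans mk.
    apply: (netB'C' (m - k)%N k 0); rewrite ?addn0 ?subnK ?(ltnW km) //.
    by apply/head0_antidiag; rewrite subKn ?(ltnW km).
  have Uu' : invmx U \in unitmx by rewrite unitmx_inv.
  have Lu1' : invmx L1 \in unitmx by rewrite unitmx_inv.
  have := net_cond_antidiagMr Uu' (is_trig_tr_inv Uu Ut) netB'C'.
  rewrite B'E mulmxK // => /(net_condMl (unitmx1 _ _) (scalar_mx_is_trig _ _)
    Lu1' (is_trig_mx_inv L1u L1t) (unitmx1 _ _) (scalar_mx_is_trig _ _)).
  rewrite mulVmx // !mul1mx; set C'' := C' *m _ => netC''.
  have C''u : C'' \in unitmx.
    apply: unitmx_ker0 => x Cx0; apply: (netC'' 0 0 m); rewrite ?addn0 //.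
    by rewrite Cx0 => i _; rewrite mxE.
  (* The triple is now [(J, 1, C'')], so [C'' *m P] is lower triangular; as [P] is an involution,
     [C''] is this matrix times [P]. *)
  exists L1, (C'' *m P), U, M.
  rewrite !inE unitmx_mul C''u pascal_unit L1u L1t Uu Ut Mu.
  rewrite net_cond_mul_pascal_trig //; split=> //.
  rewrite -B'E -[C'' *m P *m P]mulmxA pascal_mxK mulmx1 /C'' !mulmxKV //.
  by rewrite -AE.
(* Conversely, [(J, 1, P)] yields [(J, L1, L2 P)], then [(J, L1 U, L2 P U)], and finally the common
   factor [M] is appended. *)
move=> [L1 [L2 [U [M [/[!inE]/andP[L1u L1t] /andP[L2u L2t] /andP[Uu Ut] Mu]]]]].
move=> [-> -> ->]; apply: net_condMr => //.
apply: net_cond_antidiagMr => //.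
have := net_condMl (unitmx1 _ _) (scalar_mx_is_trig _ _) L1u L1t L2u L2t
                   (net_cond_pascal (m := m)).
by rewrite mul1mx mulmx1.
Qed.

(** * Binary digits *)

Lemma digit_divn (n e i : nat) : digit (n %/ 2 ^ e) i = digit n (e + i).
Proof. by rewrite /digit -divnMA expnD. Qed.

Lemma digit_inj (k n n' : nat) : (n < 2 ^ k)%N -> (n' < 2 ^ k)%N ->
  (forall i, (i < k)%N -> digit n i = digit n' i) -> n = n'.
Proof.
elim: k n n' => [|k IHk] n n'; first by rewrite expn0; lia.
rewrite expnS => nk nk' dig.
have half_eq : (n %/ 2 = n' %/ 2)%N.
  apply: IHk; [lia | lia | move=> i ik].
  by rewrite -[2%N]expn1 !digit_divn dig.
have := dig 0 isT; rewrite /digit !divn1 => odd_eq.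
by rewrite -(odd_double_half n) -(odd_double_half n') odd_eq -!divn2 half_eq.
Qed.

Lemma digit_sum (k : nat) (b : nat -> bool) :
  (\sum_(i < k) b i * 2 ^ i < 2 ^ k)%N /\
  forall i, (i < k)%N -> digit (\sum_(i < k) b i * 2 ^ i) i = b i.
Proof.
elim: k b => [|k IHk] b; first by rewrite big_ord0.
have [sum_lt sumE] := IHk (fun i => b i.+1).
have -> : (\sum_(i < k.+1) b i * 2 ^ i =
           b 0 + 2 * \sum_(i < k) b i.+1 * 2 ^ i)%N.
  rewrite big_ord_recl muln1 big_distrr /=; congr (_ + _)%N.
  by apply: eq_bigr => i _; rewrite expnS mulnCA.
set S := (\sum_(i < k) _)%N in sum_lt sumE *.
split=> [|[_|i ik]]; first by rewrite expnS; case: (b 0) => /=; lia.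
  by rewrite /digit divn1 oddD mul2n odd_double addbF oddb.
rewrite -[i.+1 in LHS]add1n -digit_divn expn1 addnC mulnC divnMDl // -sumE //.
by rewrite divn_small ?addn0 //; case: (b 0).
Qed.

Lemma F2_val (u : 'F_2) : (u : nat) = (u != 0).
Proof. by case: u => [[|[|]]]. Qed.

Lemma digit_vec_inj (m : nat) :
  injective (fun n : 'I_(2 ^ m) => digit_vec m n).
Proof.
move=> n n' /colP nn'; apply/val_inj.
apply: (digit_inj (ltn_ord n) (ltn_ord n')) => i im.
by have := nn' (Ordinal im); rewrite !mxE /=; case: digit; case: digit.
Qed.

(** Injectivity suffices, as both sides have [2^m] elements. *)
Lemma digit_vec_surj (m : nat) (x : 'cV['F_2]_m) :
  exists n : 'I_(2 ^ m), digit_vec m n = x.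
Proof.
have /codomP[n ->] : x \in codom (fun n : 'I_(2 ^ m) => digit_vec m n).
  apply: inj_card_onto; first exact: digit_vec_inj.
  by rewrite card_mx card_Fp // card_ord muln1.
by exists n.
Qed.

(** * Positions of net coordinates in dyadic intervals *)

Section Weight.

Variable m : nat.
Implicit Types (y : 'cV['F_2]_m) (k c a : nat).

(** This is the integer [2^m phi(y)]; entry 0 of [y] is its most significant digit, hence
    [rev_ord]. *)
Definition weight y : nat := \sum_(i < m) (y (rev_ord i) ord0 : nat) * 2 ^ i.

Lemma weight_spec y : (weight y < 2 ^ m)%N /\
  forall i : 'I_m, digit (weight y) (rev_ord i) = (y i ord0 != 0).
Proof.
pose b i := if insub i is Some j then y (rev_ord j) ord0 != 0 else false.
have -> : weight y = (\sum_(i < m) b i * 2 ^ i)%N.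
  by apply: eq_bigr => i _; rewrite F2_val /b valK.
have [lt_b digit_b] := digit_sum m b; split=> // i.
by rewrite digit_b // /b valK rev_ordK.
Qed.

(** Division by [2^(m-k)] keeps the [k] most significant digits, which are the first [k] entries of
    the vector. *)
Lemma weight_head k y y' : (k <= m)%N ->
  (weight y %/ 2 ^ (m - k) = weight y' %/ 2 ^ (m - k))%N <->
  head0 k (y - y').
Proof.
move=> km; have [lt_y dig_y] := weight_spec y.
have [lt_y' dig_y'] := weight_spec y'.
have F2_eq (u v : 'F_2) : (u != 0) = (v != 0) -> u = v.
  by move=> uv; apply/val_inj; rewrite /= !F2_val uv.
split=> [yy' i ik|yy'].
  rewrite !mxE; apply/eqP; rewrite subr_eq0; apply/eqP/F2_eq.
  rewrite -dig_y -dig_y' /=.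
  have -> : (m - i.+1 = m - k + (k - i.+1))%N by lia.
  by rewrite -!digit_divn yy'.
apply: (@digit_inj k); rewrite ?ltn_divLR ?expn_gt0 // -?expnD ?subnKC //.
move=> i ik; rewrite !digit_divn.
have im : (k - i.+1 < m)%N by lia.
have -> : (m - k + i = rev_ord (Ordinal im))%N by rewrite /=; lia.
rewrite dig_y dig_y'; have := yy' (Ordinal im); rewrite !mxE /= => /(_ _)/eqP.
by rewrite subr_eq0 => /(_ ltac:(lia))/eqP->.
Qed.

Variable R : realFieldType.

Lemma phi_weight y : phi R y = (weight y)%:R / 2 ^+ m.
Proof.
rewrite /phi /weight natr_sum mulr_suml (reindex_inj rev_ord_inj) /=.
apply: eq_bigr => i _; rewrite natrM -mulrA; congr (_ * _).
have -> : 2 ^+ m = 2 ^+ i * 2 ^+ (m - i.+1).+1 :> R.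
  by rewrite -exprD; congr (_ ^+ _); have := ltn_ord i; lia.
by rewrite natrX invfM mulrA mulfV ?mul1r ?expf_neq0 ?pnatr_eq0.
Qed.

Lemma phi_itv y : 0 <= phi R y < 1.
Proof.
rewrite phi_weight divr_ge0 ?exprn_ge0 ?ler0n //=.
rewrite ltr_pdivrMr ?exprn_gt0 // mul1r -natrX ltr_nat.
by case: (weight_spec y).
Qed.

Lemma phi_dyadic c a y : (c <= m)%N ->
  (dyadic R c a <= phi R y < dyadic R c a.+1) =
  (weight y %/ 2 ^ (m - c) == a)%N.
Proof.
move=> cm; have dyE b : dyadic R c b = (b * 2 ^ (m - c))%:R / 2 ^+ m.
  rewrite /dyadic natrM natrX -[in 2 ^+ m](subnKC cm) exprD invfM mulrACA.
  by rewrite mulfV ?expf_neq0 ?pnatr_eq0 // mulr1.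
rewrite phi_weight !dyE ler_pM2r ?ltr_pM2r ?invr_gt0 ?exprn_gt0 //.
rewrite ler_nat ltr_nat.
rewrite -leq_divRL ?expn_gt0 // -ltn_divLR ?expn_gt0 //.
by rewrite ltnS andbC eqn_leq.
Qed.

End Weight.

(** Two points share a box of shape [c] exactly when the chosen rows annihilate the difference of
    their digit vectors. So a trivial kernel means at most one point per box, and there are as many
    boxes as points. *)
Lemma digital_net0P (R : realFieldType) (m s : nat)
    (C : s.-tuple 'M['F_2]_m) :
  generates_digital_net R 0 C <->
  forall c : 'I_s -> nat, (\sum_(j < s) c j = m)%N ->
  forall x, (forall j, head0 (c j) (tnth C j *m x)) -> x = 0.
Proof.
have volume (c a : 'I_s -> nat) :
    \prod_(i < s) (dyadic R (c i) (a i).+1 - dyadic R (c i) (a i)) =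
      2 ^+ 0 / 2 ^+ m <-> (\sum_(j < s) c j = m)%N.
  have -> : \prod_(i < s) (dyadic R (c i) (a i).+1 - dyadic R (c i) (a i)) =
            (2 ^+ \sum_(i < s) c i)^-1.
    rewrite expr_sum -prodfV; apply: eq_bigr => i _.
    by rewrite /dyadic -mulrBl -natrB // subSnn mul1r.
  rewrite expr0 mul1r; split=> [/invr_inj/eqP|->//].
  by rewrite -!natrX eqr_nat eqn_exp2l // => /eqP.
have le_cm (c : 'I_s -> nat) :
    (\sum_(j < s) c j = m)%N -> forall j, (c j <= m)%N.
  by move=> <- j; rewrite (bigD1 j) //= leq_addr.
pose W c j (n : 'I_(2 ^ m)) :=
  (weight (tnth C j *m digit_vec m n) %/ 2 ^ (m - c j))%N.
have countE (c a : 'I_s -> nat) : (\sum_(j < s) c j = m)%N ->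
    [set n | [forall i, dyadic R (c i) (a i) <= digital_net R C n ord0 i
                        < dyadic R (c i) (a i).+1]] =
    [set n | [forall i, W c i n == a i]].
  move=> cm; apply/setP => n; rewrite !inE; apply: eq_forallb => i.
  by rewrite mxE phi_dyadic ?le_cm.
have W_head c n n' : (\sum_(j < s) c j = m)%N ->
    (forall j, W c j n = W c j n') <->
    (forall j, head0 (c j) (tnth C j *m (digit_vec m n - digit_vec m n'))).
  move=> cm; split=> H j; have := H j; rewrite mulmxBr;
    by move=> /(weight_head _ _ (le_cm c cm j)).
split=> [[_ netC] c cm x x0|kerC].
  have [n nx] := digit_vec_surj x.
  have [n0 n00] := digit_vec_surj (0 : 'cV['F_2]_m).
  have Wn0 j : W c j n0 = 0%N.
    rewrite /W n00 mulmx0 /weight big1 ?div0n // => i _; by rewrite mxE.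
  have Wn j : W c j n = 0%N.
    rewrite -(Wn0 j); move: j; apply/(W_head _ _ _ cm) => j.
    by rewrite nx n00 subr0.
  (* The box at the origin holds a single point, but contains both the one with digit vector [x] and
     the one with digit vector 0. *)
  have /eqP/cards1P[p pE] :=
    netC c (fun=> 0%N) (fun j => expn_gt0 2 (c j)) ((volume c _).2 cm).
  rewrite countE // in pE.
  have in_p q : (forall j, W c j q = 0%N) -> q = p.
    move=> q0; apply/set1P; rewrite -pE inE; apply/forallP => j.
    by rewrite q0.
  by rewrite -nx (in_p n) // -(in_p n0).
split=> [n i|c a a_lt /volume cm]; first by rewrite mxE phi_itv.
rewrite countE //.
have W_lt j n : (W c j n < 2 ^ c j)%N.
  rewrite /W ltn_divLR ?expn_gt0 // -expnD subnKC ?le_cm //.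
  by case: (weight_spec (tnth C j *m digit_vec m n)).
(* [G] maps a point to its box. It is injective by [kerC], and the number of boxes is the product of
   the [2^(c j)], that is [2^m]; hence every box is hit. *)
pose G (n : 'I_(2 ^ m)) : {dffun forall j : 'I_s, 'I_(2 ^ c j)} :=
  [ffun j => Ordinal (W_lt j n)].
have G_inj : injective G.
  move=> n n' /ffunP Gnn'; apply: digit_vec_inj; apply/eqP.
  rewrite -subr_eq0; apply/eqP; apply: (kerC c cm).
  apply/(W_head _ _ _ cm) => j.
  by have := Gnn' j; rewrite !ffunE => /(congr1 val).
have cardG : (#|{dffun forall j : 'I_s, 'I_(2 ^ c j)}| <= #|'I_(2 ^ m)|)%N.
  rewrite card_dep_ffun foldrE big_map card_ord -cm expn_sum big_enum /=.
  by apply/eq_leq/eq_bigr => j _; rewrite card_ord.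
have /codomP[n0 n0E] := inj_card_onto G_inj cardG [ffun j => Ordinal (a_lt j)].
apply/eqP/cards1P; exists n0; apply/setP => n; rewrite !inE.
apply/forallP/eqP => [Wn|-> j].
  apply: G_inj; rewrite -n0E; apply/ffunP => j; rewrite !ffunE.
  by apply/val_inj/eqP/Wn.
by have /ffunP/(_ j) := n0E; rewrite !ffunE => /(congr1 val) /= ->.
Qed.

Theorem theorem1p1 (R : realFieldType) (m : nat) (hm : (1 <= m)%N)
    (A B C : 'M['F_2]_m) :
  generates_digital_net R 0 [tuple A; B; C] <->
  exists L1 L2 U M : 'M['F_2]_m,
    [/\ L1 \in lower_unitmx m, L2 \in lower_unitmx m,
        U \in upper_unitmx m, M \in unitmx &
        (A, B, C) = (antidiag_mx m *m M,
                     L1 *m U *m M,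
                     L2 *m pascal_mx m *m U *m M)].
Proof.
rewrite -net_condP digital_net0P; split=> [ker a b c abc x Ax Bx Cx|netABC c].
  apply: (ker (tnth [tuple a; b; c])); first
    by rewrite !big_ord_recl big_ord0 /= addn0 addnA.
  by case=> [[|[|[|]]]] // ?; rewrite !(tnth_nth 0) !(tnth_nth 0%N).
rewrite !big_ord_recl big_ord0 addn0 addnA => cm x x0.
apply: (netABC _ _ _ cm).
- exact: (x0 ord0).
- exact: (x0 (lift ord0 ord0)).
- exact: (x0 (lift ord0 (lift ord0 ord0))).
Qed.
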